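(* There is a randomized protocol for solving distributed linear systems that succeeds with probability at least $0.99$ and has communication complexity $\tilde{O}(sd + d^2L)$ in the coordinator model, where $\tilde{O}(\cdot)$ hides only $\mathrm{polylog}(dL)$ factors.
   Context: There are $s\ge2$ servers $P_1,\dots,P_s$ and a coordinator; servers communicate only with the coordinator through private two-way channels. $A\in\mathbb{R}^{n\times d}$ and $b\in\mathbb{R}^n$ have integer entries in $[-2^L,2^L]$ and the rows of $[A~b]$ are partitioned among servers ($P_i$ holds $A^{(i)}x=b^{(i)}$). Solving the system: upon termination the coordinator either outputs $x$ with $Ax=b$ or reports that the system is infeasible. Communication complexity is the total number of bits sent. *)

(* Defs.v *)
From mathcomp Require Import all_boot all_order all_algebra.
From mathcomp Require Import boolp reals.

Set Implicit Arguments.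
Unset Strict Implicit.
Unset Printing Implicit Defensive.

Import Order.TTheory GRing.Theory Num.Theory.
Local Open Scope ring_scope.

(** A randomized protocol in the coordinator model for [s] servers, each with
    an input in [X], and a coordinator without input producing a value in [Y].

    Communication is counted bit by bit.  The transcript of channel [i] is the
    sequence of bits exchanged so far between the coordinator and server [i],
    in both directions.  Whose turn it is to speak on a channel is a function
    of that channel's transcript alone, hence known to both of its ends: no
    information is carried for free by silence, by timing, or by the length of
    a message.  The next bit of a server depends only on its own input, its own
    coins and its own channel; the next action of the coordinator (send a bit
    to some server, or stop with an output) depends on its own coins and on all
    channels.  Coins are private. *)
Record protocol (s : nat) (X Y : Type) := Protocol {
  coins : finType;
  server_turn : 'I_s -> seq bool -> bool;
  server_bit : 'I_s -> X -> {ffun coins -> bool} -> seq bool -> bool;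
  coordinator_action :
    {ffun coins -> bool} -> {ffun 'I_s -> seq bool} -> ('I_s * bool) + Y
}.

(** Independent fair coins: the coordinator's, then those of each server. *)
Definition coin_space s X Y (P : protocol s X Y) : finType :=
  ({ffun coins P -> bool} * {ffun 'I_s -> {ffun coins P -> bool}})%type.

Section Execution.
Variables (s : nat) (X Y : Type) (P : protocol s X Y).
Variables (x : 'I_s -> X) (w : coin_space P).

(** A server whose turn it is always sends its bit, so the coordinator cannot
    leave unread (and uncounted) bits on a channel; it acts once no server has
    the turn. *)
Definition step (t : {ffun 'I_s -> seq bool}) :
    {ffun 'I_s -> seq bool} + Y :=
  if [exists i, server_turn P i (t i)] then
    inl [ffun i => if server_turn P i (t i)
                   then rcons (t i) (server_bit i (x i) (w.2 i) (t i))
                   else t i]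
  else
    match coordinator_action w.1 t with
    | inl (i, c) => inl [ffun j => if j == i then rcons (t j) c else t j]
    | inr y => inr y
    end.

Inductive run_from :
    {ffun 'I_s -> seq bool} -> {ffun 'I_s -> seq bool} -> Y -> Prop :=
| run_stop t y : step t = inr y -> run_from t t y
| run_step t t' t'' y :
    step t = inl t' -> run_from t' t'' y -> run_from t t'' y.

Definition run (t : {ffun 'I_s -> seq bool}) (y : Y) : Prop :=
  run_from [ffun=> [::]] t y.

End Execution.

Definition bits_sent s (t : {ffun 'I_s -> seq bool}) : nat :=
  (\sum_(i < s) size (t i))%N.

Definition prob (T : finType) (E : T -> Prop) : rat :=
  #|[set w | `[< E w >]]|%:R / #|T|%:R.

Variant answer (R : Type) (d : nat) :=
| Solution of 'cV[R]_d
| Infeasible.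
Arguments Infeasible {R d}.

Definition real_mx (R : realType) m n (M : 'M[int]_(m, n)) : 'M[R]_(m, n) :=
  map_mx intr M.

Definition correct_answer (R : realType) n d
    (A : 'M[int]_(n, d)) (b : 'cV[int]_n) (y : answer R d) : Prop :=
  match y with
  | Solution x => real_mx R A *m x = real_mx R b
  | Infeasible => ~ exists x : 'cV[R]_d, real_mx R A *m x = real_mx R b
  end.

(** The rows of [A b] held by server [i] when row [r] belongs to server
    [owner r]. *)
Definition local_rows n d s (A : 'M[int]_(n, d)) (b : 'cV[int]_n)
    (owner : 'I_n -> 'I_s) (i : 'I_s) : seq ('rV[int]_d * int) :=
  [seq (row r A, b r 0) | r <- enum 'I_n & owner r == i].

(* Main.v *)
Require Import Defs.
From mathcomp Require Import all_boot all_order all_algebra.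
From mathcomp Require Import boolp reals.
From mathcomp Require Import perm zify.

Set Implicit Arguments.
Unset Strict Implicit.
Unset Printing Implicit Defensive.

Import Order.TTheory GRing.Theory Num.Theory.
Local Open Scope ring_scope.

(** The coordinator draws a random prime [p] of [O(log (d L))] bits and visits
    the servers in order, keeping a list [S] of exact integer rows of [A b] that
    are independent modulo [p].  To a server it sends [p] and a random vector
    modulo [p] orthogonal to [S]; the server answers with one of its rows not
    orthogonal to that vector, if there is one, and then [S] grows; otherwise the
    coordinator moves on.  There are at most [d + 1] rows, hence at most
    [s + d + 1] tests of [O~(d)] bits and [d + 1] transmissions of [O(d L)] bits.

    The test vector is redrawn only when [S] grows.  With [S] given, the only
    harmful event is that the vector misses the first server not covered by [S],
    so the union bound is over [d + 1] events and no [log s] appears.  If [p]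
    does not divide one fixed maximal nonzero minor of [A b], an integer with few
    prime divisors, then rows spanning modulo [p] span over the reals, and
    the collected rows determine the solution set.  The primes dividing a central
    binomial coefficient supply enough small moduli. *)

(** * Small primes from central binomial coefficients *)

Lemma expn2_leq_central_bin n : (2 ^ n <= 'C(n.*2, n))%N.
Proof.
elim: n => [|n IHn] //; rewrite doubleS binS expnS mul2n -addnn leq_add //.
  by rewrite binS (leq_trans IHn) // leq_addl.
by rewrite (leq_trans IHn) // leq_bin2l.
Qed.

(* Each summand of Legendre's formula for [(2n)! / (n!)^2] is at most 1, and it
   vanishes once [p ^ k > 2n]. *)
Lemma prime_power_central_bin p n :
  prime p -> (0 < n)%N -> (p ^ logn p 'C(n.*2, n) <= n.*2)%N.
Proof.
move=> p_pr n_gt0; have p_gt1 := prime_gt1 p_pr.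
suff le_log : (logn p 'C(n.*2, n) <= trunc_log p n.*2)%N.
  apply: leq_trans (trunc_logP p_gt1 _); last by rewrite double_gt0.
  by rewrite leq_exp2l.
have le_n2 : (n <= n.*2)%N by rewrite -addnn leq_addr.
have := congr1 (logn p) (bin_fact le_n2).
have -> : (n.*2 - n = n)%N by rewrite -addnn addnK.
rewrite !lognM ?muln_gt0 ?fact_gt0 ?bin_gt0 ?le_n2 // !logn_fact //.
have ext : (\sum_(1 <= k < n.+1) n %/ p ^ k
    = \sum_(1 <= k < n.*2.+1) n %/ p ^ k)%N.
  rewrite [RHS](big_cat_nat (n := n.+1)) //=.
  rewrite [X in (_ + X)%N]big_nat_cond [X in (_ + X)%N]big1 ?addn0 // => i.
  case/andP=> /andP[lt_ni _] _; apply: divn_small; apply: leq_trans lt_ni _.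
  exact/ltnW/ltn_expl.
rewrite ext addnn => eq_log.
have : (\sum_(1 <= k < n.*2.+1) n.*2 %/ p ^ k <=
        (\sum_(1 <= k < n.*2.+1) n %/ p ^ k).*2 + trunc_log p n.*2)%N.
  have -> : trunc_log p n.*2 = (\sum_(1 <= k < n.*2.+1) (p ^ k <= n.*2))%N.
    rewrite (big_cat_nat (n := (trunc_log p n.*2).+1)) //=; last first.
      rewrite ltnS (leq_trans (ltnW (ltn_expl _ p_gt1))) //.
      by apply: trunc_logP; rewrite ?double_gt0.
    rewrite big_nat_cond (eq_bigr (fun=> 1%N)) => [|i]; last first.
      case/andP=> /andP[_ le_i] _; rewrite (leq_trans _ (trunc_logP p_gt1 _)) //.
        by rewrite leq_exp2l.
      by rewrite double_gt0.
    rewrite -big_nat_cond sum_nat_const_nat subn1 muln1 /=.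
    rewrite [X in (_ + X)%N]big_nat_cond [X in (_ + X)%N]big1 ?addn0 // => i.
    case/andP=> /andP[lt_i _] _; rewrite leqNgt.
    by rewrite (leq_trans (trunc_log_ltn _ p_gt1)) // leq_exp2l.
  rewrite -[(bigop _ _ _).*2]addnn -!big_split /= leq_sum // => k _.
  have pk_gt0 : (0 < p ^ k)%N by rewrite expn_gt0 prime_gt0.
  rewrite -addnn divnD // leq_add2l; case: (leqP (p ^ k) (n + n)) => lt_pk;
    first exact: leq_b1.
  rewrite leqn0 eqb0 -ltnNge; apply: leq_ltn_trans lt_pk.
  by rewrite leq_add ?leq_mod.
by rewrite -eq_log addnC leq_add2l.
Qed.

Lemma prime_dvd_fact p n : prime p -> (p %| n`!)%N -> (p <= n)%N.
Proof.
move=> p_pr; elim: n => [|n IHn].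
  by rewrite fact0 dvdn1 => /eqP p1; rewrite p1 in p_pr.
by rewrite factS Euclid_dvdM // => /orP[/dvdn_leq-> // | /IHn/leqW].
Qed.

(** With [n = 2 ^ a], the central coefficient is at least [2 ^ n] and its prime power factors are at
    most [2 ^ a.+1], so it has at least [2 ^ a / a.+1] prime divisors. The lower bound on the primes
    keeps [2 ^ m] residues distinct. *)
Lemma many_primes m : exists ps : seq nat,
  [/\ uniq ps, size ps = (2 ^ m)%N &
      {in ps, forall p, prime p /\ (2 ^ m <= p < 2 ^ (m.*2 + 8))%N}].
Proof.
pose a := (m.*2 + 6)%N; pose n := (2 ^ a)%N; pose c := 'C(n.*2, n).
have n2E : n.*2 = (2 ^ a.+1)%N by rewrite expnS mul2n.
have n_gt0 : (0 < n)%N by rewrite expn_gt0.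
have c_gt0 : (0 < c)%N by rewrite bin_gt0 -addnn leq_addr.
have size_pr : (2 ^ a <= a.+1 * size (primes c))%N.
  rewrite -(leq_exp2l (m := 2)) // -/n.
  apply: leq_trans (expn2_leq_central_bin n) _; rewrite -/c.
  rewrite {1}(prod_prime_decomp c_gt0) prime_decompE big_map /= expnM -n2E.
  have: {in primes c, forall p, prime p}.
    by move=> p; rewrite mem_primes => /andP[].
  elim: (primes c) => [|p ps IHps] ps_pr; first by rewrite big_nil.
  rewrite big_cons /= expnS leq_mul ?prime_power_central_bin ?ps_pr ?mem_head //.
  by apply: IHps => p' ps_p'; rewrite ps_pr // inE ps_p' orbT.
pose ps := [seq p <- primes c | (2 ^ m <= p)%N].
have ups : uniq ps by rewrite filter_uniq // primes_uniq.
have size_ps : (2 ^ m <= size ps)%N.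
  have := count_predC (fun p => 2 ^ m <= p)%N (primes c).
  rewrite -size_filter -/ps => eq_size.
  have le_small : (count (predC (fun p => 2 ^ m <= p)%N) (primes c) <= 2 ^ m)%N.
    rewrite -size_filter -[X in (_ <= X)%N](size_iota 0); apply: uniq_leq_size.
      by rewrite filter_uniq // primes_uniq.
    by move=> p; rewrite mem_filter mem_iota /= -ltnNge => /andP[].
  (* The choice of [a] serves this: there are twice [2 ^ m] prime divisors, half of which may be
     discarded as too small. *)
  have : (a.+1 * 2 ^ m.+1 <= 2 ^ a)%N.
    have -> : (2 ^ a = 2 ^ (m + 5) * 2 ^ m.+1)%N.
      by rewrite -expnD /a; congr (2 ^ _)%N; lia.
    rewrite leq_mul2r; apply/orP; right.
    have := ltn_expl m (isT : (1 < 2)%N); rewrite expnD -[(2 ^ 5)%N]/32%N /a; lia.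
  move/leq_trans/(_ size_pr); rewrite leq_mul2l /= expnS mul2n -addnn -eq_size.
  by move=> le_sum; rewrite -(leq_add2r (2 ^ m)) (leq_trans le_sum) // leq_add2l.
exists (take (2 ^ m) ps); split; first exact: take_uniq.
  by rewrite size_takel.
move=> p /mem_take; rewrite mem_filter mem_primes => /and3P[-> p_pr].
case/andP=> _ p_dvd; split=> //=.
have : (p %| n.*2`!)%N.
  by rewrite -(bin_fact (m := n)) ?dvdn_mulr // -addnn leq_addr.
move/(prime_dvd_fact p_pr)/leq_ltn_trans; apply.
by rewrite n2E ltn_exp2l // /a; lia.
Qed.

(** * Ranks of integer matrices over different fields *)

Lemma minor_mxrank (F : fieldType) m n (M : 'M[F]_(m, n)) :
  exists (f : 'I_(\rank M) -> 'I_m) (g : 'I_(\rank M) -> 'I_n),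
    \det (mxsub f g M) != 0.
Proof.
pose N := rowsub (maxrankfun M) M.
have fullN : row_full N^T.
  by rewrite /row_full mxrank_tr; have := maxrowsub_free M; rewrite /row_free.
exists (maxrankfun M), (fullrankfun fullN).
rewrite -unitfE -unitmxE -unitmx_tr.
suff -> : (mxsub (maxrankfun M) (fullrankfun fullN) M)^T
          = rowsub (fullrankfun fullN) N^T by exact: fullrowsub_unit.
by apply/matrixP=> i j; rewrite !mxE.
Qed.

Lemma leq_mxrank_minor (F : fieldType) m n r (M : 'M[F]_(m, n))
    (f : 'I_r -> 'I_m) (g : 'I_r -> 'I_n) :
  \det (mxsub f g M) != 0 -> (r <= \rank M)%N.
Proof.
rewrite -unitfE -unitmxE -row_free_unit => /eqP <-.
have -> : mxsub f g M = rowsub f 1%:M *m (M *m colsub g 1%:M).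
  apply/matrixP=> i j; rewrite mul_rowsub_mx mul1mx mulmx_colsub mulmx1.
  by rewrite !mxE.
exact: leq_trans (mxrankM_maxr _ _) (mxrankM_maxl _ _).
Qed.

Lemma det_intr (F : fieldType) m n r (M : 'M[int]_(m, n))
    (f : 'I_r -> 'I_m) (g : 'I_r -> 'I_n) :
  \det (mxsub f g (map_mx intr M)) = (\det (mxsub f g M))%:~R :> F.
Proof. by rewrite -map_mxsub det_map_mx. Qed.

(** A minor nonzero in [F] is the image of a nonzero integer, which stays nonzero in characteristic
    0. *)
Lemma mxrank_intr_pchar0 (F : fieldType) (K : numFieldType) m n
    (M : 'M[int]_(m, n)) :
  (\rank (map_mx intr M : 'M[F]_(m, n)) <=
   \rank (map_mx intr M : 'M[K]_(m, n)))%N.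
Proof.
have [f [g]] := minor_mxrank (map_mx intr M : 'M[F]_(m, n)).
rewrite det_intr => D_neq0; apply: (leq_mxrank_minor (f := f) (g := g)).
by rewrite det_intr intr_eq0; apply: contraNneq D_neq0 => ->.
Qed.

Lemma norm_det_le (K : numDomainType) r (M : 'M[K]_r) (B : K) :
  (forall i j, `|M i j| <= B) -> `|\det M| <= r`!%:R * B ^+ r.
Proof.
move=> MB; apply: le_trans (ler_norm_sum _ _ _) _.
rewrite -card_Sn mulr_natl -sumr_const.
apply: ler_sum => s _; rewrite normrM normrX normrN1 expr1n mul1r normr_prod.
rewrite -[r in B ^+ r]card_ord -prodr_const.
by apply: ler_prod => i _; rewrite normr_ge0 MB.
Qed.

(* The modulus is bad for [M] only when it divides this one minor. *)
Lemma mxrank_intr_Fp (K : numFieldType) m n (M : 'M[int]_(m, n)) L :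
    (forall i j, `|M i j| <= 2 ^+ L) ->
  exists D : nat, [/\ (0 < D)%N, (D <= 2 ^ (n * (n + L)))%N &
    forall p, prime p -> ~~ (p %| D)%N ->
      (\rank (map_mx intr M : 'M[K]_(m, n)) <=
       \rank (map_mx intr M : 'M['F_p]_(m, n)))%N].
Proof.
move=> ML; have [f [g]] := minor_mxrank (map_mx intr M : 'M[K]_(m, n)).
set r := \rank _ in f g *; rewrite det_intr intr_eq0 => D_neq0.
exists `|\det (mxsub f g M)|%N; split; first by rewrite absz_gt0.
  have : `|\det (mxsub f g M)| <= r`!%:R * (2 ^+ L) ^+ r.
    by apply: norm_det_le => i j; rewrite mxE.
  rewrite -abszE -!natrX -natrM natz lez_nat => /leq_trans; apply.
  (* Bounding [r] by the number of columns keeps the bound on [D], hence the size of the primes,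
     independent of the number of rows. *)
  have le_rn : (r <= n)%N by exact: rank_leq_col.
  have le_fact k : (k`! <= 2 ^ (k * k))%N.
    elim: k => // k IHk; rewrite factS.
    have -> : (k.+1 * k.+1 = (k + k.+1) + k * k)%N by lia.
    rewrite expnD leq_mul // (leq_trans (ltnW (ltn_expl _ (isT : (1 < 2)%N)))) //.
    by rewrite leq_exp2l // leq_addl.
  rewrite -expnM (leq_trans (leq_mul (le_fact r) (leqnn _))) // -expnD.
  by rewrite leq_exp2l // mulnDr (mulnC L) leq_add ?leq_mul.
move=> p p_pr p_ndvd.
apply: (leq_mxrank_minor (f := f) (g := g)); rewrite det_intr.
by rewrite -(dvdz_pcharf (pchar_Fp p_pr)).
Qed.

Lemma size_prime_divisors n ps : (0 < n)%N -> uniq ps ->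
  {in ps, forall p, prime p /\ (p %| n)%N} -> (2 ^ size ps <= n)%N.
Proof.
move=> n_gt0 ups ps_pr.
have : (2 ^ size (primes n) <= n)%N.
  rewrite [X in (_ <= X)%N](prod_prime_decomp n_gt0) prime_decompE big_map /=.
  have: {in primes n, forall p, (2 <= p ^ logn p n)%N}.
    move=> p; rewrite -logn_gt0 => n_p; apply: leq_trans (leq_pexp2l _ n_p).
      by move: n_p; rewrite expn1 logn_gt0 mem_primes => /andP[/prime_gt1].
    by move: n_p; rewrite logn_gt0 mem_primes => /andP[/prime_gt0].
  elim: (primes n) => [|p qs IHqs] qs2; first by rewrite big_nil.
  rewrite big_cons /= expnS leq_mul ?qs2 ?mem_head //.
  by apply: IHqs => q qs_q; rewrite qs2 // inE qs_q orbT.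
apply: leq_trans; rewrite leq_exp2l // uniq_leq_size // => p.
by rewrite mem_primes n_gt0 => /ps_pr[-> ->].
Qed.

(** * Spans of lists of integer rows over a field *)

Section RowSpan.
Variable k : nat.
Implicit Types (S : seq 'rV[int]_k) (r : 'rV[int]_k).

Definition seq_mx S : 'M[int]_(size S, k) := \matrix_(i < size S) S`_i.

Definition span (F : fieldType) S : 'M[F]_(size S, k) := map_mx intr (seq_mx S).

Lemma row_span F S i : row i (span F S) = map_mx intr S`_i.
Proof. by rewrite -map_row rowK. Qed.

Lemma mem_span F S r : r \in S -> (map_mx intr r <= span F S)%MS.
Proof.
move=> S_r; have lt_r : (index r S < size S)%N by rewrite index_mem.
by rewrite -(nth_index 0 S_r) -(row_span F (Ordinal lt_r)) row_sub.
Qed.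

Lemma span_subP (F : fieldType) m S (M : 'M[F]_(m, k)) :
  reflect {in S, forall r, (map_mx intr r <= M)%MS} (span F S <= M)%MS.
Proof.
apply: (iffP idP) => [leSM r /(mem_span F)/submx_trans | leSM]; first exact.
by apply/row_subP=> i; rewrite row_span leSM ?mem_nth.
Qed.

(* Passing to ['F_p] can only lower ranks, and by assumption it keeps that of
   [M], so rows spanning modulo [p] already span over [K]. *)
Lemma span_lift (K : numFieldType) (F : fieldType) m (M : 'M[int]_(m, k)) S :
    (\rank (map_mx intr M : 'M[K]_(m, k)) <=
     \rank (map_mx intr M : 'M[F]_(m, k)))%N ->
    {in S, forall r, exists i, r = row i M} ->
    (map_mx intr M <= span F S)%MS -> (map_mx intr M <= span K S)%MS.
Proof.
move=> le_rank SM leMS.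
have leSM : (span K S <= map_mx intr M)%MS.
  by apply/span_subP=> r /SM[i ->]; rewrite map_row row_sub.
rewrite -(geq_leqif (mxrank_leqif_sup leSM)) (leq_trans le_rank) //.
by rewrite (leq_trans (mxrankS leMS)) // mxrank_intr_pchar0.
Qed.

Lemma span_rcons F S r : (span F (rcons S r) :=: span F S + map_mx intr r)%MS.
Proof.
apply/eqmxP/andP; split.
  apply/span_subP=> r'; rewrite mem_rcons inE => /orP[/eqP->|S_r'].
    exact: addsmxSr.
  exact: submx_trans (mem_span F S_r') (addsmxSl _ _).
rewrite addsmx_sub mem_span ?mem_rcons ?mem_head // andbT.
by apply/span_subP=> r' S_r'; rewrite mem_span // mem_rcons inE S_r' orbT.
Qed.

Lemma ltn_rank_span F S r : ~~ (map_mx intr r <= span F S)%MS ->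
  (\rank (span F S) < \rank (span F (rcons S r)))%N.
Proof.
move=> r_notin; rewrite (span_rcons F S r).
rewrite (ltn_leqif (mxrank_leqif_sup (addsmxSl _ _))).
by rewrite addsmx_sub submx_refl.
Qed.

End RowSpan.

(** * Interactive programs and their execution as protocols *)

Definition set_at (I : finType) (T : Type) (t : {ffun I -> T}) i u :=
  [ffun j => if j == i then u else t j].

Section InteractivePrograms.
Variables (s : nat) (X Y : Type).

(* [Ask i b k]: the coordinator sends [b] to server [i], which replies with one
   bit.  The two ends of a channel speak alternately, so the parity of the
   length of a transcript tells whose turn it is. *)
Inductive prog := Ret of Y | Ask of 'I_s & bool & (bool -> prog).

(** The coordinator acts on transcripts alone, so the program is rerun from its start, each [Ask]
    consuming a sent bit and its reply, until the channel asked has no recorded pair left. *)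
Fixpoint replay (pr : prog) (t : {ffun 'I_s -> seq bool}) : ('I_s * bool) + Y :=
  match pr with
  | Ret y => inr y
  | Ask i b k =>
      if t i is _ :: r :: u then replay (k r) (set_at t i u) else inl (i, b)
  end.

Variables (St : Type) (st0 : St) (upd : St -> bool -> St) (out : X -> St -> bool).

(* Bits at odd positions are the server's own replies, which its state
   ignores. *)
Definition server_state (t : seq bool) : bool * St :=
  foldl (fun z b => if z.1 then (false, z.2) else (true, upd z.2 b))
        (false, st0) t.

Lemma server_state_rcons t b :
  server_state (rcons t b) =
  if odd (size t) then (false, (server_state t).2)
  else (true, upd (server_state t).2 b).
Proof.
suff parity u : (server_state u).1 = odd (size u).
  by rewrite -parity /server_state foldl_rcons.
elim/last_ind: u => // u c IHu.
rewrite /server_state foldl_rcons -/(server_state u) IHu size_rcons /=.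
by case: odd.
Qed.

Definition compile (I : finType) (pr : {ffun I -> bool} -> prog) :
    protocol s X Y :=
  Protocol (fun _ t => odd (size t))
           (fun _ x _ t => out x (server_state t).2)
           (fun c t => replay (pr c) t).

Variable x : 'I_s -> X.

Fixpoint exec (pr : prog) (sg : {ffun 'I_s -> St}) : Y * nat :=
  match pr with
  | Ret y => (y, 0)
  | Ask i b k =>
      let st := upd (sg i) b in
      let yc := exec (k (out (x i) st)) (set_at sg i st) in (yc.1, yc.2.+1)
  end.

(** Generalized to the middle of a run for the induction: [sg] holds the server states determined by
    the transcripts [t], and by the last hypothesis replaying the whole program past [t] amounts to
    replaying the remainder [pr]. *)
Lemma run_compile_from (I : finType) (pr0 : {ffun I -> bool} -> prog)
    (w : coin_space (compile pr0)) (pr : prog)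
    (t : {ffun 'I_s -> seq bool}) (sg : {ffun 'I_s -> St}) :
    (forall i, ~~ odd (size (t i))) ->
    (forall i, sg i = (server_state (t i)).2) ->
    (forall e : {ffun 'I_s -> seq bool},
       replay (pr0 w.1) [ffun i => t i ++ e i] = replay pr e) ->
  exists t', run_from x w t t' (exec pr sg).1 /\
             bits_sent t' = (bits_sent t + (exec pr sg).2.*2)%N.
Proof.
elim: pr t sg => [y | i b k IHk] t sg t_even sgE prE.
  exists t; split; last by rewrite addn0.
  apply: run_stop; rewrite /step /=; case: existsP => [[i]|_].
    by rewrite (negbTE (t_even i)).
  have /= := prE [ffun=> [::]]; set t0 := finfun _.
  by have -> : t0 = t; [apply/ffunP=> i; rewrite !ffunE cats0 | move=> ->].
pose st := upd (sg i) b; pose r := out (x i) st.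
pose t1 := set_at t i (rcons (t i) b).
pose t2 := set_at t i (rcons (rcons (t i) b) r).
have step1 : step x w t = inl t1.
  rewrite /step /=; case: existsP => [[j]|_]; first by rewrite (negbTE (t_even j)).
  have /= := prE [ffun=> [::]]; set t0 := finfun _.
  have -> : t0 = t; first by apply/ffunP=> j; rewrite !ffunE cats0.
  rewrite ffunE => -> /=; congr inl; apply/ffunP=> j.
  by rewrite !ffunE; case: eqP => // ->.
have st1 : server_state (rcons (t i) b) = (true, st).
  by rewrite server_state_rcons (negbTE (t_even i)) -sgE.
have step2 : step x w t1 = inl t2.
  rewrite /step; case: existsP => [_|[]]; last first.
    by exists i; rewrite /= ffunE eqxx size_rcons /= t_even.
  congr inl; apply/ffunP=> j; rewrite /= !ffunE.
  case: eqP => [-> | _]; last by rewrite (negbTE (t_even j)).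
  by rewrite size_rcons /= t_even st1.
have [||e|t' [run_t' size_t']] := IHk r t2 (set_at sg i st).
- move=> j; rewrite ffunE; case: eqP => // _.
  by rewrite !size_rcons /= negbK.
- move=> j; rewrite !ffunE; case: eqP => // _.
  by rewrite server_state_rcons size_rcons /= t_even st1.
(* The exchange just made moves from the transcript into the extension, where [replay] consumes
   it. *)
- pose e' := set_at e i [:: b, r & e i].
  have -> : [ffun j => t2 j ++ e j] = [ffun j => t j ++ e' j].
    apply/ffunP=> j; rewrite !ffunE; case: eqP => // ->.
    by rewrite -!cats1 -!catA.
  rewrite prE /= ffunE eqxx; congr replay.
  by apply/ffunP=> j; rewrite !ffunE; case: eqP => // ->.
exists t'; split; first exact: run_step step1 (run_step step2 run_t').
rewrite size_t' /= doubleS !addnS -!addSn; congr addn.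
rewrite /bits_sent (bigD1 i) //= [in RHS](bigD1 i) //= ffunE eqxx !size_rcons.
congr (_ + _).+2; apply: eq_bigr => j /negbTE nij.
by rewrite ffunE nij.
Qed.

Lemma run_compile (I : finType) (pr : {ffun I -> bool} -> prog)
    (w : coin_space (compile pr)) :
  let yc := exec (pr w.1) [ffun=> st0] in
  exists t, run x w t yc.1 /\ bits_sent t = yc.2.*2.
Proof.
have [i|i|e|t [run_t size_t]] := @run_compile_from _ _ w (pr w.1) [ffun=> [::]]
  [ffun=> st0].
- by rewrite ffunE.
- by rewrite !ffunE.
- by congr replay; apply/ffunP=> i; rewrite !ffunE.
exists t; split=> //; rewrite size_t /bits_sent big1 // => i _.
by rewrite ffunE.
Qed.

End InteractivePrograms.

(** * Multi-bit queries over single-bit exchanges *)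

Section Queries.
Variables (s : nat) (X Y : Type) (ans : X -> seq bool -> seq bool).
Local Notation prog := (prog s Y).

(* The coordinator's bits come in pairs: [(false, b)] appends [b] to the
   server's query buffer, [(true, _)] asks for the next bit of the answer to the
   query in the buffer.  The state holds the first half of an incomplete pair,
   the buffer, and the number of answer bits read so far; the first bit written
   after a reading phase starts a new query. *)
Definition query_state : Type := (option bool * seq bool * nat)%type.

Definition query_init : query_state := (None, [::], 0).

Definition query_upd (st : query_state) (b : bool) : query_state :=
  match st with
  | (None, q, c) => (Some b, q, c)
  | (Some false, q, c) => (None, if c == 0%N then rcons q b else [:: b], 0)
  | (Some true, q, c) => (None, q, c.+1)
  end.

(** The predecessor is there because the counter advances before the reply is computed. *)
Definition query_out (x : X) (st : query_state) : bool :=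
  nth false (ans x st.1.2) st.2.-1.

(** No half pair is pending, and the next bit written starts a query: the buffer is empty, or an
    answer bit has been read since. *)
Definition query_ready (st : query_state) : bool :=
  (st.1.1 == None) && ((st.1.2 == [::]) || (0 < st.2)%N).

Fixpoint send (i : 'I_s) (q : seq bool) (pr : prog) : prog :=
  if q is b :: q' then
    Ask i false (fun _ => Ask i b (fun _ => send i q' pr))
  else pr.

Fixpoint receive (i : 'I_s) (m : nat) (k : seq bool -> prog) : prog :=
  if m is m'.+1 then
    Ask i true (fun _ =>
      Ask i true (fun b => receive i m' (fun r => k (b :: r))))
  else k [::].

Definition query i q m k := send i q (receive i m k).

Variable x : 'I_s -> X.

(** Demanding the same outcome from all ready states lets queries be chained without tracking what
    earlier ones left at the servers. *)
Definition yields (pr : prog) (y : Y) (c : nat) : Prop :=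
  forall sg : {ffun 'I_s -> query_state},
    (forall j, query_ready (sg j)) ->
    exec query_upd query_out x pr sg = (y, c).

Lemma exec_send i q pr (sg : {ffun 'I_s -> query_state}) buf y c :
    sg i = (None, buf, 0) ->
    (forall j, j != i -> query_ready (sg j)) ->
    (forall sg' : {ffun 'I_s -> query_state}, sg' i = (None, buf ++ q, 0) ->
       (forall j, j != i -> query_ready (sg' j)) ->
       exec query_upd query_out x pr sg' = (y, c)) ->
  exec query_upd query_out x (send i q pr) sg = (y, c + (size q).*2)%N.
Proof.
elim: q sg buf c => [|b q IHq] sg buf c sgi rdy exec_pr.
  by rewrite addn0; apply: exec_pr; rewrite ?cats0.
rewrite /= sgi /= !ffunE eqxx /=.
rewrite (IHq _ (rcons buf b) c) /=; first by rewrite doubleS !addnS.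
- by rewrite !ffunE eqxx.
- by move=> j nji; rewrite !ffunE (negbTE nji) rdy.
- by rewrite cat_rcons.
Qed.

Lemma exec_receive i m k (sg : {ffun 'I_s -> query_state}) buf cnt y c :
    sg i = (None, buf, cnt) -> (0 < cnt + m)%N ->
    (forall j, j != i -> query_ready (sg j)) ->
    yields (k [seq nth false (ans (x i) buf) n | n <- iota cnt m]) y c ->
  exec query_upd query_out x (receive i m k) sg = (y, c + m.*2)%N.
Proof.
elim: m k sg cnt => [|m IHm] k sg cnt sgi cm_gt0 rdy yk.
  rewrite addn0; apply: yk => j; have [-> | /rdy//] := eqVneq j i.
  by rewrite sgi /query_ready /= -[cnt]addn0 cm_gt0 orbT.
rewrite /= sgi /= !ffunE eqxx /= /query_out /=.
rewrite (IHm _ _ cnt.+1) /= ?doubleS ?addnS //.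
- by rewrite !ffunE eqxx.
- by move=> j nji; rewrite !ffunE (negbTE nji) rdy.
Qed.

Lemma yields_query i q m k y c : (0 < size q)%N -> (0 < m)%N ->
    yields (k (mkseq (nth false (ans (x i) q)) m)) y c ->
  yields (query i q m k) y (c + (size q + m).*2)%N.
Proof.
case: q => // b q _ m_gt0 yk sg rdy; rewrite /query /=.
have := rdy i; case sgi: (sg i) => [[pend buf] cnt] /andP[/eqP /= pendE bufE].
rewrite pendE /= !ffunE eqxx /=.
have -> : (if cnt == 0 then rcons buf b else [:: b])%N = [:: b].
  by case: (posnP cnt) bufE => [_ | _ _ //]; rewrite orbF => /eqP->.
rewrite (@exec_send _ _ _ _ [:: b] y (c + m.*2)%N) /=.
- by rewrite !doubleD doubleS; congr pair; lia.
- by rewrite !ffunE eqxx.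
- by move=> j nji; rewrite !ffunE (negbTE nji) rdy.
- by move=> sg' sg'i rdy'; apply: (exec_receive sg'i).
Qed.

End Queries.

(** * Fixed-length codes and the check of one server *)

Lemma binary_code (T : finType) (x0 : T) N : (#|T| <= 2 ^ N)%N ->
  exists (enc : T -> seq bool) (dec : seq bool -> T),
    cancel enc dec /\ forall x, size (enc x) = N.
Proof.
move=> leTN; have cardN : #|{: N.-tuple bool}| = (2 ^ N)%N.
  by rewrite card_tuple card_bool.
have leT : (#|T| <= #|{: N.-tuple bool}|)%N by rewrite cardN.
pose code x : N.-tuple bool := enum_val (widen_ord leT (enum_rank x)).
have code_inj : injective code.
  by move=> x y /enum_val_inj/(congr1 val)/= /val_inj/enum_rank_inj.
exists code, (fun u => odflt x0 [pick x | tval (code x) == u]).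
split=> [x|x]; last exact: size_tuple.
case: pickP => [y /eqP/val_inj/code_inj-> // | /(_ x)].
by rewrite eqxx.
Qed.

Section Messages.
Variables (s : nat) (X Y : Type) (QT RT : Type) (respond : X -> QT -> option RT).
Variables (encQ : QT -> seq bool) (decQ : seq bool -> QT) (NQ : nat).
Variables (encR : RT -> seq bool) (decR : seq bool -> RT) (NR : nat).
Hypothesis encQK : cancel encQ decQ.
Hypothesis size_encQ : forall q, size (encQ q) = NQ.+1.
Variable valid : pred RT.
Hypothesis encRK : {in valid, cancel encR decR}.
Hypothesis size_encR : forall r, size (encR r) = NR.

Definition message_ans (x : X) (q : seq bool) : seq bool :=
  if respond x (decQ q) is Some r then true :: encR r else [::].

(* The flag is read first, since reading a whole row at every check would cost
   [s * d * L] bits. *)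
Definition check (i : 'I_s) (q : QT) (k : option RT -> prog s Y) : prog s Y :=
  query i (encQ q) 1 (fun f =>
    if head false f then
      query i (encQ q) NR.+1 (fun u => k (Some (decR (behead u))))
    else k None).

Variable x : 'I_s -> X.
Hypothesis respond_valid :
  forall i q r, respond (x i) q = Some r -> valid r.

Lemma yields_check i q k y c :
    yields message_ans x (k (respond (x i) q)) y c ->
  yields message_ans x (check i q k) y
    (c + (if respond (x i) q is Some _ then (NQ.+2 + (NQ.+2 + NR)).*2
          else NQ.+2.*2))%N.
Proof.
move=> yk; pose a := message_ans (x i) (encQ q).
have aE : a = if respond (x i) q is Some r then true :: encR r else [::].
  by rewrite /a /message_ans encQK.
case resp: (respond (x i) q) aE yk => [r|] aE yk; last first.
  rewrite -(size_encQ q) -[(size _).+1]addn1; apply: yields_query => //.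
    by rewrite size_encQ.
  by rewrite -/a aE.
rewrite -[(c + _)%N]/(c + (NQ.+2 + (NQ.+2 + NR)).*2)%N.
have -> : (c + (NQ.+2 + (NQ.+2 + NR)).*2 = c + (size (encQ q) + NR.+1).*2
           + (size (encQ q) + 1).*2)%N by rewrite size_encQ; lia.
apply: yields_query => //; first by rewrite size_encQ.
rewrite -/a aE /=; apply: yields_query => //; first by rewrite size_encQ.
have -> : mkseq (nth false a) NR.+1 = a.
  by rewrite -[RHS](mkseq_nth false) aE /= size_encR.
by rewrite aE /= encRK //; apply: respond_valid resp.
Qed.

End Messages.

(** * The spanning game and its failure probability *)

Lemma card_tupleS (T : finType) n (E : pred (seq T)) :
  #|[set t : n.+1.-tuple T | E t]| =
  (\sum_u #|[set t : n.-tuple T | E (u :: t)]|)%N.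
Proof.
rewrite -sum1dep_card.
rewrite (reindex (fun z : T * n.-tuple T => [tuple of z.1 :: z.2])) /=.
  under [RHS]eq_bigr do rewrite -sum1dep_card.
  by rewrite pair_big_dep.
exists (fun t => (thead t, [tuple of behead t])) => [[u t] _ | t _] /=.
  by congr pair; apply: val_inj.
by rewrite -tuple_eta.
Qed.

Section SpanningGame.
Variables (s k : nat) (F : fieldType) (Q : finType) (coef : Q -> F).
Variable rows : 'I_s -> seq 'rV[int]_k.
Hypothesis coef_inj : injective coef.
Local Notation B := {ffun 'I_k -> Q}.
Implicit Types (S : seq 'rV[int]_k) (us : seq B) (l : seq 'I_s).

Definition first_row (rs : seq 'rV[int]_k) (v : 'cV[F]_k) : option 'rV[int]_k :=
  ohead [seq r <- rs | map_mx intr r *m v != 0].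

(* A random vector orthogonal to [S]: it detects a row outside the span of [S]
   except with probability [1 / #|Q|]. *)
Definition test_vector S (u : B) : 'cV[F]_k :=
  cokermx (span F S) *m \col_j coef (u j).

(** One [u] is kept while [scan] passes over servers with nothing to report. Once a row is found,
    the game resumes at the same server with the next vector. *)
Fixpoint play us S : seq 'I_s -> seq 'rV[int]_k :=
  if us is u :: us' then
    fix scan l :=
      if l is i :: l' then
        if first_row (rows i) (test_vector S u) is Some r
        then play us' (rcons S r) l else scan l'
      else S
  else fun=> S.

Definition covered S (i : 'I_s) : bool :=
  all (fun r => map_mx intr r <= span F S)%MS (rows i).

Lemma first_rowP S i u r : first_row (rows i) (test_vector S u) = Some r ->
  r \in rows i /\ ~~ (map_mx intr r <= span F S)%MS.
Proof.
rewrite /first_row; set rs := filter _ _ => rsE.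
have : r \in rs by case: rs rsE => // _ rs [->]; rewrite mem_head.
rewrite mem_filter => /andP[r_v ->]; split=> //.
apply: contraNN r_v; rewrite submxE => /eqP r0.
by rewrite /test_vector mulmxA r0 mul0mx.
Qed.

Lemma first_row_covered S i u :
  covered S i -> first_row (rows i) (test_vector S u) = None.
Proof.
move/allP=> cov; case E: first_row => [r|//].
by have [/cov ->] := first_rowP E.
Qed.

Lemma play_ind (P : seq 'rV[int]_k -> Prop) :
    (forall S i r, P S -> r \in rows i -> P (rcons S r)) ->
  forall us S l, P S -> P (play us S l).
Proof.
move=> Prcons; elim=> [//|u us IHus] S.
elim=> [//|i l IHl] PS /=; case E: first_row => [r|]; last exact: IHl.
by apply: IHus; apply: (Prcons _ i) => //; case: (first_rowP E).
Qed.

Lemma covered_play us S l i : covered S i -> covered (play us S l) i.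
Proof.
apply: (@play_ind (fun S' => covered S i -> covered S' i)) => // S' j r IH _.
move/IH/allP=> cov; apply/allP=> r' /cov/submx_trans; apply.
by rewrite span_rcons addsmxSl.
Qed.

(** Every missing [u] satisfies a fixed nonzero linear equation, so one of its entries is determined
    by the others. Overwriting that entry by any element of [Q] is therefore injective on pairs. *)
Lemma missed_le S i : ~~ covered S i ->
  (#|[set u | first_row (rows i) (test_vector S u) == None]| * #|Q| <= #|B|)%N.
Proof.
case/allPn=> r ir; rewrite submxE => /rV0Pn[j0 aj0].
set A := [set u | _]; set a := _ *m _ in aj0.
have zeroA u : u \in A -> \sum_j a 0 j * coef (u j) = 0.
  rewrite inE => /eqP; rewrite /first_row; set rs := filter _ _ => rsE.
  have : r \notin rs by case: rs rsE.
  rewrite mem_filter ir andbT negbK mulmxA -/a => /eqP/matrixP/(_ 0 0).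
  by rewrite !mxE => {2}<-; apply: eq_bigr => j _; rewrite !mxE.
rewrite -(cardsT Q) -cardsX.
apply: (@leq_card_in _ _ (fun z : B * Q => set_at z.1 j0 z.2)).
move=> [u q] [u' q']; rewrite !in_setX !in_setT !andbT /= => Au Au' /ffunP eq_uu.
have eq_q : q = q' by have := eq_uu j0; rewrite !ffunE eqxx.
have eq_u j : j != j0 -> u j = u' j.
  by move=> njj0; have := eq_uu j; rewrite !ffunE (negbTE njj0).
congr pair; last exact: eq_q; apply/ffunP=> j.
have [->|/eq_u//] := eqVneq j j0; apply: coef_inj.
have := etrans (zeroA u Au) (esym (zeroA u' Au')).
rewrite (bigD1 j0) //= [RHS](bigD1 j0) //=.
rewrite [X in _ = _ + X -> _](eq_bigr (fun j => a 0 j * coef (u j))).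
  by move/addIr/(mulfI aj0).
by move=> j' nj; rewrite eq_u.
Qed.

Definition failures n S l :=
  [set us : n.-tuple B | ~~ all (covered (play us S l)) l].

(* Whether round [j] fails depends, given the earlier rounds, only on the first
   server not yet covered, so the union bound runs over at most [k] rounds
   whatever the number of servers. *)
Lemma card_failures n S l : (k <= \rank (span F S) + n)%N ->
  (#|failures n S l| * #|Q| <= n * #|B| ^ n)%N.
Proof.
elim: n S l => [|n IHn] S l.
  rewrite addn0 mul0n leqn0 muln_eq0 cards_eq0 => full_S.
  have fullS : row_full (span F S).
    by rewrite /row_full eqn_leq rank_leq_col full_S.
  suff -> : failures 0 S l = set0 by rewrite eqxx.
  apply/setP=> us; rewrite !inE; apply/negbTE; rewrite negbK.
  by apply/allP=> i _; apply: covered_play; apply/allP=> r _; apply: submx_full.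
move=> rank_S; elim: l => [|i l IHl].
  suff -> : failures n.+1 S [::] = set0 by rewrite cards0.
  by apply/setP=> us; rewrite !inE.
(* A covered server answers no test, so it is dropped with nothing charged to the error. *)
have [cov_i | ncov_i] := boolP (covered S i).
  suff -> : failures n.+1 S (i :: l) = failures n.+1 S l by [].
  apply/setP=> us; rewrite !inE; case/tupleP: us => u us.
  have -> : play [tuple of u :: us] S (i :: l) = play [tuple of u :: us] S l.
    by rewrite /= first_row_covered.
  have allE P : all P (i :: l) = P i && all P l by [].
  by rewrite allE covered_play.
rewrite /failures (card_tupleS n (fun us => ~~ all (covered (play us S _)) _)).
rewrite big_distrl /=.
set missed := [pred u | first_row (rows i) (test_vector S u) == None].
(* At an uncovered server, a missing vector is charged with all its continuations; any other vector
   raises the rank, and the induction on rounds applies. *)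
apply: (@leq_trans (\sum_u (missed u * #|Q| * #|B| ^ n + n * #|B| ^ n))%N).
  apply: leq_sum => u _; case E: first_row => [r|] /=; last first.
    rewrite E eqxx mul1n mulnC (leq_trans _ (leq_addr _ _)) // leq_mul2l.
    by rewrite -(card_tuple n B) max_card orbT.
  rewrite E /= mul0n add0n; apply: (IHn (rcons S r) (i :: l)).
  have [_ /ltn_rank_span] := first_rowP E; move: rank_S; lia.
rewrite big_split /= sum_nat_const cardT -cardE -!big_distrl /= -/B.
have missedE : (\sum_u missed u)%N = #|[set u | missed u]|.
  by rewrite -sum1dep_card [RHS]big_mkcond; apply: eq_bigr => u _ /=; case: ifP.
rewrite missedE mulSn expnS mulnCA leq_add2r.
by rewrite leq_mul2r missed_le ?orbT.
Qed.

Variables (X Y : Type) (x : 'I_s -> X) (fin : seq 'rV[int]_k -> Y).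
Variables (QT : Type) (respond : X -> QT -> option 'rV[int]_k).
Variables (encQ : QT -> seq bool) (decQ : seq bool -> QT) (NQ : nat).
Variables (encR : 'rV[int]_k -> seq bool) (decR : seq bool -> 'rV[int]_k).
Variables (NR : nat) (valid : pred 'rV[int]_k) (msg : 'cV[F]_k -> QT).
Hypothesis encQK : cancel encQ decQ.
Hypothesis size_encQ : forall q, size (encQ q) = NQ.+1.
Hypothesis encRK : {in valid, cancel encR decR}.
Hypothesis size_encR : forall r, size (encR r) = NR.
Hypothesis respond_valid :
  forall i q r, respond (x i) q = Some r -> valid r.
Hypothesis respond_msg : forall i v, respond (x i) (msg v) = first_row (rows i) v.

Fixpoint collect us S : seq 'I_s -> prog s Y :=
  if us is u :: us' then
    fix scan l :=
      if l is i :: l' then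
        check encQ decR NR i (msg (test_vector S u)) (fun o =>
          if o is Some r then collect us' (rcons S r) l else scan l')
      else Ret s (fin S)
  else fun=> Ret s (fin S).

(** A found row uses up a vector and an empty reply uses up a server, whence the two terms. *)
Lemma yields_collect us S l : exists2 c,
  yields (message_ans respond decQ encR) x (collect us S l) (fin (play us S l)) c
  & (c <= size us * (NQ.+2 + (NQ.+2 + NR)).*2 + size l * NQ.+2.*2)%N.
Proof.
elim: us S l => [|u us IHus] S l; first by exists 0%N.
elim: l => [|i l [c yc le_c]]; first by exists 0%N.
pose chk := yields_check (Y := Y) encQK size_encQ encRK size_encR respond_valid.
case E: (first_row (rows i) (test_vector S u)) => [r|].
  have [c' yc' le_c'] := IHus (rcons S r) (i :: l).
  exists (c' + (NQ.+2 + (NQ.+2 + NR)).*2)%N.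
    rewrite /= E; have := chk i (msg (test_vector S u)).
    by rewrite respond_msg E; apply.
  by rewrite [size (u :: us)]/= mulSn; lia.
exists (c + NQ.+2.*2)%N.
  rewrite /= E; have := chk i (msg (test_vector S u)).
  by rewrite respond_msg E; apply.
by rewrite [size (i :: l)]/= mulSn; lia.
Qed.

End SpanningGame.

(** * Codes for moduli, test vectors and rows *)

Lemma query_code w k :
  exists (enc : 'I_(2 ^ w).-1.+1 * 'cV['I_(2 ^ w).-1.+1]_k -> seq bool) dec,
    cancel enc dec /\ forall q, size (enc q) = (w * k.+1)%N.
Proof.
apply: binary_code; first exact: (ord0, const_mx ord0).
rewrite card_prod card_mx card_ord prednK ?expn_gt0 // muln1 -expnM -expnD.
by rewrite mulnS.
Qed.

Definition bounded_row k (L : nat) : pred 'rV[int]_k :=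
  [pred r : 'rV[int]_k | [forall j, `|r 0 j| <= 2 ^+ L]].

(** Shifted by [2 ^ L], an entry takes [2 ^ L.+1 + 1] values, one too many for [L.+1] bits. *)
Lemma row_code k L : exists (enc : 'rV[int]_k -> seq bool) dec,
  {in @bounded_row k L, cancel enc dec} /\
  forall r, size (enc r) = (L.+2 * k)%N.
Proof.
pose T := 'rV['I_(2 ^ L.+1).+1]_k.
have [||enc [dec [encK size_enc]]] := @binary_code T _ (L.+2 * k).
- exact: const_mx ord0.
- rewrite card_mx card_ord mul1n expnM; case: (k) => // k'.
  by rewrite leq_exp2r // [X in (_ <= X)%N]expnS mul2n -addnn -addn1 leq_add2l
    expn_gt0.
exists (fun r => enc (map_mx (fun z : int => inord (absz (z + 2 ^+ L))) r)).
exists (fun u => map_mx (fun z : 'I__ => (z : nat)%:Z - 2 ^+ L) (dec u)).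
split=> [r /forallP bnd_r | r]; last exact: size_enc.
rewrite encK; apply/matrixP=> i j; rewrite !mxE ord1.
have := bnd_r j; rewrite ler_norml => /andP[lo hi].
have ge0 : 0 <= r 0 j + 2 ^+ L by rewrite -(opprK (2 ^+ L)) subr_ge0.
rewrite inordK; first by rewrite gez0_abs // addrK.
rewrite ltnS -lez_nat gez0_abs // expnS mul2n -addnn PoszD.
by rewrite -natz natrX lerD2r.
Qed.

(** * From counting bad coins to probability *)

Lemma card_bad (T1 T2 : finType) (P : pred T1) (E : T1 -> {set T2}) K n c :
    (#|P| <= K)%N ->
    (forall a, ~~ P a -> (#|E a| * #|T1| <= n * #|T2|)%N) ->
    (c * (K + n) <= #|T1|)%N ->
  (c * #|[set z : T1 * T2 | P z.1 || (z.2 \in E z.1)]| <= #|{: T1 * T2}|)%N.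
Proof.
move=> leK leE le_c; set bad := [set z | _].
have badE : #|bad| = (\sum_a #|[set t | P a || (t \in E a)]|)%N.
  rewrite -sum1dep_card -(pair_big_dep predT (fun a t => P a || (t \in E a))
    (fun _ _ => 1%N)) /=.
  by apply: eq_bigr => a _; rewrite sum1dep_card.
rewrite card_prod; have [T1_0 | T1_gt0] := posnP #|T1|.
  suff -> : bad = set0 by rewrite cards0 muln0.
  by apply/setP=> -[a t]; have := card0_eq T1_0 a; rewrite inE.
rewrite -(leq_pmul2r T1_gt0) -mulnA.
apply: (@leq_trans (c * ((K + n) * #|T1| * #|T2|)))%N; last first.
  rewrite -(mulnA (K + n)%N) mulnA [X in (_ <= X)%N]mulnC leq_mul2r.
  by rewrite le_c orbT.
rewrite leq_mul2l; apply/orP; right; rewrite badE big_distrl /=.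
apply: (@leq_trans (\sum_a (P a * (#|T1| * #|T2|) + n * #|T2|)))%N.
  apply: leq_sum => a _; have [Pa | nPa] := boolP (P a).
    rewrite mul1n (leq_trans _ (leq_addr _ _)) // mulnC leq_mul2l.
    by rewrite max_card orbT.
  rewrite mul0n add0n (leq_trans _ (leE _ nPa)) // leq_mul2r.
  by apply/orP; right; apply: subset_leq_card; apply/subsetP=> t; rewrite inE.
rewrite big_split /= sum_nat_const -big_distrl /= cardT -cardE.
have -> : (\sum_a P a)%N = #|P|.
  rewrite -sum1_card [RHS]big_mkcond; apply: eq_bigr => a _.
  by rewrite unfold_in; case: (P a).
rewrite !mulnDl -!mulnA; apply: leq_add; first exact: leq_mul.
by rewrite mulnCA.
Qed.

Lemma ler_nat_ratio (a b x y : nat) : (0 < b)%N -> (0 < y)%N ->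
  (a * y <= x * b)%N -> a%:R / b%:R <= x%:R / y%:R :> rat.
Proof.
move=> b_gt0 y_gt0 le_ab; rewrite ler_pdivrMr ?ltr0n // mulrAC.
by rewrite ler_pdivlMr ?ltr0n // -!natrM ler_nat.
Qed.

Lemma prob_ge (T1 T2 : finType) (bad : {set T1}) (E : T1 * T2 -> Prop) :
    (0 < #|{: T1 * T2}|)%N -> (100 * #|bad| <= #|T1|)%N ->
    (forall w, w.1 \notin bad -> E w) ->
  99%:R / 100%:R <= prob E.
Proof.
move=> card_gt0 le_bad goodE.
apply: ler_nat_ratio => //.
have : (#|setX (~: bad) [set: T2]| <= #|[set w | `[< E w >]]|)%N.
  apply: subset_leq_card; apply/subsetP=> -[a b].
  rewrite in_setX !inE andbT => nbad; apply/asboolP; exact: goodE.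
rewrite cardsX cardsT cardsCs setCK card_prod.
move: #|bad| #|T1| #|T2| #|_| le_bad => x t1 t2 y le_x le_y.
apply: leq_trans (leq_mul le_y (leqnn 100)); rewrite mulnAC mulnA leq_mul2r.
by apply/orP; right; lia.
Qed.

(** * The coordinator's coins as a prime seed and test vectors *)

Section CoinSplit.
Variables (m k : nat).
Local Notation Q := {ffun 'I_m -> bool}.
Definition coin_index : finType := ('I_m + 'I_k * ('I_k * 'I_m))%type.

Definition split_coins (w : {ffun coin_index -> bool}) :
    Q * k.-tuple {ffun 'I_k -> Q} :=
  ([ffun a => w (inl a)],
   [tuple [ffun j => [ffun a => w (inr (t, (j, a)))]] | t < k]).

Lemma split_coins_bij : bijective split_coins.
Proof.
apply: inj_card_bij => [w w' eq_w|].
  have /ffunP eq1 := congr1 fst eq_w; have eq2 := congr1 snd eq_w.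
  apply/ffunP=> -[a | [t [j a]]]; first by have := eq1 a; rewrite !ffunE.
  have := congr1 (fun z => tnth z t) eq2; rewrite !tnth_mktuple.
  by move/ffunP/(_ j); rewrite !ffunE => /ffunP/(_ a); rewrite !ffunE.
rewrite card_prod card_tuple !card_ffun card_bool !card_ord.
rewrite card_sum !card_prod !card_ord -!expnM -expnD.
by rewrite leq_exp2l //; nia.
Qed.
End CoinSplit.

(** * The linear system in terms of collected rows *)

Section LinearSystem.
Variable d : nat.

Definition augment (x : seq ('rV[int]_d * int)) : seq 'rV[int]_(d + 1) :=
  [seq row_mx z.1 z.2%:M | z <- x].

Lemma augment_local_rows n s (A : 'M[int]_(n, d)) (b : 'cV[int]_n)
    (owner : 'I_n -> 'I_s) i :
  augment (local_rows A b owner i) =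
  [seq row r (row_mx A b) | r <- enum 'I_n & owner r == i].
Proof.
rewrite /augment /local_rows -map_comp; apply: eq_map => r /=.
by rewrite row_row_mx [row r b]mx11_scalar mxE.
Qed.

Definition respond_mod (x : seq ('rV[int]_d * int)) (p : nat)
    (v : 'cV[nat]_(d + 1)) : option 'rV[int]_(d + 1) :=
  first_row (augment x) (map_mx (fun z => z%:R) v : 'cV['F_p]_(d + 1)).

Definition respond w (x : seq ('rV[int]_d * int))
    (q : 'I_(2 ^ w).-1.+1 * 'cV['I_(2 ^ w).-1.+1]_(d + 1)) :=
  respond_mod x q.1 (map_mx (@nat_of_ord _) q.2).

Definition modular_message w p (v : 'cV['F_p]_(d + 1)) :
    'I_(2 ^ w).-1.+1 * 'cV['I_(2 ^ w).-1.+1]_(d + 1) :=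
  (inord p, map_mx (fun z : 'F_p => inord z) v).

(** Both [p] and its residues are below [2 ^ w], so [inord] loses nothing. *)
Lemma respond_message w x p v : prime p -> (p < 2 ^ w)%N ->
  respond x (@modular_message w p v) = first_row (augment x) v.
Proof.
move=> p_pr lt_p; rewrite /respond /respond_mod /= inordK ?prednK ?expn_gt0 //.
congr first_row; apply/matrixP=> i j; rewrite !mxE inordK ?natr_Zp //.
rewrite prednK ?expn_gt0 // (leq_trans (ltn_ord _)) // Fp_cast //.
exact: ltnW.
Qed.

Variable R : realType.

(** Appending -1 to [v] turns the system into orthogonality to the rows of [[A b]], which depends
    only on their span. *)
Definition solves (S : seq 'rV[int]_(d + 1)) (v : 'cV[R]_d) : Prop :=
  {in S, forall r, map_mx intr r *m col_mx v (- 1%:M) = 0}.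

Definition solve S : answer R d :=
  if pselect (exists v, solves S v) is left ex then Solution (projT1 (cid ex))
  else Infeasible.

Lemma correct_solve n (A : 'M[int]_(n, d)) (b : 'cV[int]_n) S :
    {in S, forall r, exists i, r = row i (row_mx A b)} ->
    (map_mx intr (row_mx A b) <= span R S)%MS ->
  correct_answer A b (solve S).
Proof.
move=> SA leAS.
have systemE v : real_mx R A *m v = real_mx R b <->
    map_mx intr (row_mx A b) *m col_mx v (- 1%:M) = 0 :> 'cV[R]_n.
  rewrite map_row_mx mul_row_col mulmxN mulmx1 -/(real_mx R A) -/(real_mx R b).
  by split=> [-> | /eqP]; rewrite ?subrr // subr_eq0 => /eqP.
have solvesP v : solves S v <-> real_mx R A *m v = real_mx R b.
  rewrite systemE; split=> [Sv | Av r /SA[i ->]]; last first.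
    by rewrite map_row -row_mul Av row0.
  have /submxP[D ->] := leAS; rewrite -mulmxA.
  suff -> : span R S *m col_mx v (- 1%:M) = 0 by rewrite mulmx0.
  by apply/row_matrixP=> i; rewrite row_mul row_span row0 Sv ?mem_nth.
rewrite /solve; case: pselect => [ex | nex] /=.
  by case: cid => v /= /solvesP.
by case=> v /solvesP Sv; apply: nex; exists v.
Qed.

End LinearSystem.

(** * Seeds, primes and numerical parameters *)

Lemma coef_Fp_inj (T : finType) p : prime p -> (#|T| <= p)%N ->
  injective (fun q : T => (enum_rank q)%:R : 'F_p).
Proof.
move=> p_pr leTp q q' /(congr1 val); rewrite /= !val_Fp_nat //.
rewrite !modn_small ?(leq_trans (ltn_ord _)) //.
by move/val_inj/enum_rank_inj.
Qed.

(** Distinct seeds select distinct primes, and a positive number is at least 2 to the number of its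
    prime divisors. *)
Lemma card_bad_primes (T : finType) (ps : seq nat) D K :
    uniq ps -> size ps = #|T| -> {in ps, forall p, prime p} ->
    (0 < D)%N -> (D <= 2 ^ K)%N ->
  (#|[pred t : T | nth 2 ps (enum_rank t) %| D]| <= K)%N.
Proof.
move=> ups size_ps ps_pr D_gt0 leDK; set P := [pred t | _].
have lt_rank (t : T) : (enum_rank t < size ps)%N by rewrite size_ps.
rewrite cardE -(size_map (fun t => nth 2 ps (enum_rank t))).
rewrite -(leq_exp2l (m := 2)) // (leq_trans _ leDK) //.
apply: size_prime_divisors => // [|p].
  rewrite map_inj_in_uniq ?enum_uniq // => t t' _ _ /eqP.
  by rewrite nth_uniq // => /eqP/val_inj/enum_rank_inj.
case/mapP=> t; rewrite mem_enum => Pt ->; split=> //.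
by apply: ps_pr; apply: mem_nth.
Qed.

(** The inner sum counts bad primes and rounds, the right side is the number of seeds: the error is
    at most 1/100. *)
Lemma parameter_bound d L : (1 <= d)%N -> (1 <= L)%N ->
  (100 * ((d + 1) * (d + 1 + L) + (d + 1)) <=
   2 ^ ((trunc_log 2 (d * L)).*2 + 12))%N.
Proof.
move=> d_gt0 L_gt0; set a := (d * L)%N.
have lt_a := trunc_log_ltn a (isT : (1 < 2)%N).
have le_da : (d <= a)%N by rewrite leq_pmulr.
have le_La : (L <= a)%N by rewrite leq_pmull.
have a_gt0 : (0 < a)%N by rewrite muln_gt0 d_gt0.
have -> : ((trunc_log 2 a).*2 + 12 =
           (trunc_log 2 a).+1 + (trunc_log 2 a).+1 + 10)%N by lia.
rewrite !expnD -[(2 ^ 10)%N]/1024%N.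
move: (2 ^ _)%N lt_a => e; nia.
Qed.

(** A test consists of [d + 2] numbers of [4h + 32] bits. The constant is 4 * (2 * 194 + 12), with
    one doubling for the pairing of the coordinator's bits and one for the replies. *)
Lemma cost_bound s d L h NQ : (1 <= d)%N -> (1 <= L)%N ->
    NQ = (((h.*2 + 12).*2 + 8) * (d + 1).+1)%N ->
  (((d + 1) * (NQ.+1 + (NQ.+1 + L.+2 * (d + 1))).*2 + s * NQ.+1.*2).*2 <=
   1600 * (s * d + d ^ 2 * L) * h.+1 ^ 1)%N.
Proof.
move=> d_gt0 L_gt0 NQE.
have le_NQ : (NQ.+1 <= 97 * (d * h.+1))%N by nia.
move: NQ.+1 le_NQ {NQE} => N le_N.
have le1 : ((d + 1) * N <= 194 * (d ^ 2 * L * h.+1))%N.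
  apply: leq_trans (leq_mul (_ : d + 1 <= d.*2)%N le_N) _; first by lia.
  rewrite -mul2n; have : (d * (d * h.+1) <= d * (d * h.+1) * L)%N.
    by rewrite leq_pmulr.
  nia.
have le2 : ((d + 1) * (L.+2 * (d + 1)) <= 12 * (d ^ 2 * L * h.+1))%N.
  apply: (@leq_trans (d.*2 * (3 * L * d.*2))).
    by rewrite !leq_mul //; lia.
  rewrite -!mul2n; have : (d ^ 2 * L <= d ^ 2 * L * h.+1)%N by rewrite leq_pmulr.
  nia.
have le3 : (s * N <= 97 * (s * d * h.+1))%N.
  by apply: leq_trans (leq_mul (leqnn s) le_N) _; nia.
rewrite expn1; move: le1 le2 le3; rewrite -!mul2n mulnDr mulnDl.
set e1 := (d ^ 2 * L * h.+1)%N; set e2 := (s * d * h.+1)%N.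
have -> : (1600 * (s * d + d ^ 2 * L) * h.+1 = 1600 * (e1 + e2))%N.
  by rewrite /e1 /e2; nia.
nia.
Qed.

(** * Assembling the protocol from its parts *)

Theorem theorem4p4 (R : realType) :
  exists C k : nat,
  forall s d L : nat, (2 <= s)%N -> (1 <= d)%N -> (1 <= L)%N ->
  exists P : protocol s (seq ('rV[int]_d * int)) (answer R d),
  forall (n : nat) (A : 'M[int]_(n, d)) (b : 'cV[int]_n)
         (owner : 'I_n -> 'I_s),
    (forall i j, `|A i j| <= 2 ^+ L) ->
    (forall i, `|b i 0| <= 2 ^+ L) ->
    99%:R / 100%:R <=
      prob (fun w : coin_space P =>
              exists t y, run (local_rows A b owner) w t y /\
                          correct_answer A b y)
    /\
    (forall w : coin_space P,
       exists t y, run (local_rows A b owner) w t y /\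
         (bits_sent t <=
            C * (s * d + d ^ 2 * L) * (trunc_log 2 (d * L)).+1 ^ k)%N).
Proof.
exists 1600, 1%N => s d L _ d_gt0 L_gt0.
pose h := trunc_log 2 (d * L); pose m := (h.*2 + 12)%N.
pose w := (m.*2 + 8)%N; pose k := (d + 1)%N.
have [ps [ups size_ps ps_pr]] := many_primes m.
have [encQ [decQ [encQK size_encQ]]] := query_code w k.
have [encR [decR [encRK size_encR]]] := row_code k L.
(* Elements of [Q] serve both as seeds selecting the prime and as entries of the test vectors. *)
pose Q : finType := {ffun 'I_m -> bool}.
have cardQ : #|Q| = (2 ^ m)%N by rewrite card_ffun card_bool card_ord.
(* The default 2 is never reached, as [ps] has exactly [#|Q|] elements. *)
pose pr (q : Q) := nth 2 ps (enum_rank q).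
have pr_prime q : prime (pr q) /\ (2 ^ m <= pr q < 2 ^ w)%N.
  by apply/ps_pr/mem_nth; rewrite size_ps -cardQ.
pose coef p (q : Q) : 'F_p := (enum_rank q)%:R.
pose NR := (L.+2 * k)%N.
pose program (c : {ffun coin_index m k -> bool}) :=
  let z := split_coins c in
  collect (coef (pr z.1)) (@solve d R) encQ decR NR
    (@modular_message d w (pr z.1)) z.2 [::] (enum 'I_s).
pose ans := message_ans (@respond d w) decQ encR.
exists (compile query_init query_upd (query_out ans) program).
move=> n A b owner A_bnd b_bnd; set x := local_rows A b owner.
pose M := row_mx A b; pose rows i := augment (x i).
have M_bnd i j : `|M i j| <= 2 ^+ L.
  by rewrite mxE; case: split => j'; rewrite ?ord1.
have rowsM i r : r \in rows i -> exists i', r = row i' M.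
  by rewrite /rows augment_local_rows => /mapP[i' _ ->]; exists i'.
have respond_bnd i q r : @respond d w (x i) q = Some r -> @bounded_row k L r.
  rewrite /respond /respond_mod /first_row; set rs := filter _ _ => rsE.
  have : r \in rs by case: (rs) rsE => // _ ? [->]; rewrite mem_head.
  rewrite mem_filter => /andP[_ /rowsM[i' ->]].
  by apply/forallP=> j; rewrite mxE.
have sizeQ q : size (encQ q) = (w * k.+1).-1.+1.
  by rewrite size_encQ prednK // muln_gt0 addn_gt0 orbT.
pose result c := let z := split_coins c in
  play (coef (pr z.1)) rows z.2 [::] (enum 'I_s).
(* The cost and the form of the output hold for all coins; only correctness is left to chance. *)
have runP (c : coin_space (compile query_init query_upd (query_out ans) program)) :
    exists t, run x c t (solve R (result c.1)) /\ (bits_sent t <=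
      1600 * (s * d + d ^ 2 * L) * (trunc_log 2 (d * L)).+1 ^ 1)%N.
  pose z := split_coins c.1; have [p_pr /andP[_ lt_p]] := pr_prime z.1.
  have [cost yc le_cost] := yields_collect (coef (pr z.1)) (rows := rows)
    (@solve d R) encQK sizeQ encRK size_encR respond_bnd
    (fun i v => respond_message (x i) v p_pr lt_p) z.2 [::] (enum 'I_s).
  have [t] := run_compile x c.
  rewrite yc /= => [|j]; last by rewrite ffunE.
  case=> run_t size_t.
  exists t; split=> //; rewrite size_t.
  apply: leq_trans _ (cost_bound s (h := h) d_gt0 L_gt0 (erefl _)); rewrite leq_double.
  apply: leq_trans le_cost _; rewrite size_tuple size_enum_ord prednK //.
  by rewrite muln_gt0 addn_gt0 orbT.
split=> [|c]; last first.
  by have [t [run_t le_t]] := runP c; exists t, (solve R (result c.1)).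
have [D [D_gt0 le_D rank_D]] := mxrank_intr_Fp R M_bnd.
pose bad := [set z : Q * k.-tuple {ffun 'I_k -> Q} |
  (pr z.1 %| D)%N ||
  (z.2 \in failures (coef (pr z.1)) rows k [::] (enum 'I_s))].
have coef_inj q : injective (coef (pr q)).
  by have [p_pr /andP[le_p _]] := pr_prime q; apply: coef_Fp_inj; rewrite ?cardQ.
have card_bad_le : (100 * #|bad| <= #|{: Q * k.-tuple {ffun 'I_k -> Q}}|)%N.
  apply: (@card_bad _ _ (fun q => pr q %| D)%N
    (fun q => failures (coef (pr q)) rows k [::] (enum 'I_s)) (k * (k + L)) k).
  - apply: card_bad_primes => //; first by rewrite size_ps -cardQ.
    by move=> p /ps_pr[].
  - move=> q _; rewrite card_tuple; apply: card_failures; first exact: coef_inj.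
    exact: leq_addl.
  - by rewrite cardQ; apply: parameter_bound.
have split_bij := split_coins_bij m k.
apply: (@prob_ge _ _ (@split_coins m k @^-1: bad)).
- by rewrite !card_prod !card_ffun card_bool muln_gt0 !expn_gt0.
- rewrite on_card_preimset; last exact: onW_bij.
  by rewrite (bij_eq_card split_bij).
move=> c; rewrite inE => good_c; have [t [run_t _]] := runP c.
exists t, (solve R (result c.1)); split=> //.
move: good_c; rewrite inE; set z := split_coins _ => /norP[ndvd].
rewrite inE negbK => /allP cov.
have result_rows : {in result c.1, forall r, exists i, r = row i M}.
  apply: (@play_ind _ _ _ _ _ _
    (fun S => {in S, forall r, exists i, r = row i M})) => // S i r SM ir r'.
  by rewrite mem_rcons inE => /orP[/eqP-> | /SM //]; apply: rowsM ir.
apply: correct_solve => //.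
(* Off the bad event the prime does not divide [D] and every server is covered modulo the prime, so
   the collected rows span over the reals. *)
apply: (@span_lift _ _ 'F_(pr z.1)) => //.
  by apply: rank_D => //; case: (pr_prime z.1).
apply/row_subP=> i; rewrite -map_row.
have /allP := cov (owner i) (mem_enum _ _); apply.
rewrite /rows augment_local_rows; apply/mapP; exists i => //.
by rewrite mem_filter eqxx mem_enum.
Qed.
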